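(* Let $\mathbb{G}$ be a compact quantum group of Kac type, $\mathcal{A}=\mathrm{Pol}(\mathbb{G})$ and $\mathcal{A}^{\mathrm{cop}}=\mathrm{Pol}(\mathbb{G}^{\mathrm{cop}})$. Then the following equality of subspaces of $\mathcal{A}\odot\mathcal{A}^{\mathrm{cop}}$ holds: \[ \widetilde{\Delta}(\mathcal{A}) = E_{\phi_D}(\mathcal{A}\odot\mathcal{A}^{\mathrm{cop}}).\]
   Context: $\mathrm{Pol}(\mathbb{G})$ is the Hopf $*$-algebra of the compact quantum group $\mathbb{G}$, with coproduct $\Delta$, antipode $S$ and Haar state $h$. $\mathbb{G}$ is of Kac type if $h$ is a trace. $\mathbb{G}^{\mathrm{cop}}$ is the compact quantum group obtained from $\mathbb{G}$ by keeping the $*$-algebra and replacing $\Delta$ by $\Sigma\circ\Delta$, $\Sigma$ being the tensor flip; $\widetilde{\ }:\mathcal{A}\to\mathcal{A}^{\mathrm{cop}}$ denotes the formal identity map. $\mathcal{A}\odot\mathcal{A}^{\mathrm{cop}}$ (algebraic tensor product) has the coproduct $\Delta^{\iota,\mathrm{cop}}(a\otimes\widetilde b)=a_{(1)}\otimes\widetilde{b_{(2)}}\otimes a_{(2)}\otimes\widetilde{b_{(1)}}$ (Sweedler notation). Define the functional $\phi_D$ on $\mathcal{A}\odot\mathcal{A}^{\mathrm{cop}}$ by $\phi_D(a\otimes\widetilde b)=h(a\,S(b))$ (extended linearly), the map $E_{\phi_D}=(\mathrm{id}_{\mathcal{A}\odot\mathcal{A}^{\mathrm{cop}}}\otimes\phi_D)\circ\Delta^{\iota,\mathrm{cop}}:\mathcal{A}\odot\mathcal{A}^{\mathrm{cop}}\to\mathcal{A}\odot\mathcal{A}^{\mathrm{cop}}$,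 and the injective map $\widetilde\Delta=(\mathrm{id}_{\mathcal{A}}\otimes\widetilde{\ })\circ\Delta:\mathcal{A}\to\mathcal{A}\odot\mathcal{A}^{\mathrm{cop}}$. *)

(* Defs.v *)
From HB Require Import structures.
From mathcomp Require Import all_boot all_order all_algebra.
From mathcomp Require Import boolp classical_sets reals.
From mathcomp Require Import complex.

Set Implicit Arguments.
Unset Strict Implicit.
Unset Printing Implicit Defensive.

Import Order.TTheory GRing.Theory Num.Theory.

Local Open Scope ring_scope.
Local Open Scope quotient_scope.

Reserved Notation "A ⊙ B" (at level 40, left associativity).
Reserved Notation "a ⊗ b" (at level 40, left associativity).

Section TensorProduct.
Context {K : comNzRingType} (A B : lmodType K).

Definition balanced (W : zmodType) (f : A -> B -> W) : Prop :=
  [/\ forall a a' b, f (a + a') b = f a b + f a' b,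
      forall a b b', f a (b + b') = f a b + f a b'
    & forall (c : K) a b, f (c *: a) b = f a (c *: b)].

(* A finite list of pairs stands for the formal sum of the corresponding      *)
(* simple tensors; two formal sums are identified when no balanced map        *)
(* separates them. The universal property is [tliftE] (existence, with        *)
(* [tliftD]) and [tens_ind] (uniqueness).                                     *)
Definition teq (s t : seq (A * B)) : bool :=
  `[< forall (W : zmodType) (f : A -> B -> W), balanced f ->
        \sum_(p <- s) f p.1 p.2 = \sum_(p <- t) f p.1 p.2 >].

Lemma teq_refl : reflexive teq.
Proof. by move=> s; apply/asboolP. Qed.

Lemma teq_sym : symmetric teq.
Proof.
by move=> s t; apply/idP/idP => /asboolP e; apply/asboolP => W f bf;
  rewrite (e W f bf).
Qed.

Lemma teq_trans : transitive teq.
Proof.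
move=> s t u /asboolP e1 /asboolP e2; apply/asboolP => W f bf.
by rewrite (e1 W f bf) (e2 W f bf).
Qed.

Canonical teq_equiv := EquivRel teq teq_refl teq_sym teq_trans.

Definition tensor : Type := {eq_quot teq}.

HB.instance Definition _ := Choice.on tensor.
HB.instance Definition _ := EqQuotient.on tensor.

Definition tens (a : A) (b : B) : tensor := \pi_tensor [:: (a, b)].

(* The additive map induced by [f]; only meaningful when [f] is balanced.     *)
Definition tlift (W : zmodType) (f : A -> B -> W) (t : tensor) : W :=
  \sum_(p <- repr t) f p.1 p.2.

Lemma tlift_pi (W : zmodType) (f : A -> B -> W) (s : seq (A * B)) :
  balanced f -> tlift f (\pi_tensor s) = \sum_(p <- s) f p.1 p.2.
Proof.
move=> bf; rewrite /tlift.
have /eqmodP/asboolP := reprK (\pi_tensor s).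
exact.
Qed.

Lemma tlift_inj (t t' : tensor) :
  (forall (W : zmodType) (f : A -> B -> W), balanced f ->
     tlift f t = tlift f t') -> t = t'.
Proof.
move=> e; rewrite -[t]reprK -[t']reprK; apply/eqmodP/asboolP => W f bf.
exact: e.
Qed.

Lemma tliftE (W : zmodType) (f : A -> B -> W) (a : A) (b : B) :
  balanced f -> tlift f (tens a b) = f a b.
Proof. by move=> bf; rewrite tlift_pi// big_seq1. Qed.

Lemma balanced0l (W : zmodType) (f : A -> B -> W) b : balanced f -> f 0 b = 0.
Proof. by case=> fD _ _; apply: (addIr (f 0 b)); rewrite -fD !add0r. Qed.

Lemma balancedNl (W : zmodType) (f : A -> B -> W) a b :
  balanced f -> f (- a) b = - f a b.
Proof.
move=> bf; have [fD _ _] := bf.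
by apply: (addIr (f a b)); rewrite -fD !addNr balanced0l.
Qed.

Lemma balanced_scale (W : zmodType) (f : A -> B -> W) c :
  balanced f -> balanced (fun a b => f (c *: a) b).
Proof.
case=> fDl fDr fZ; split=> [a a' b|a b b'|d a b].
- by rewrite scalerDr fDl.
- by rewrite fDr.
- by rewrite scalerA mulrC -scalerA fZ.
Qed.

Let tadd (s t : tensor) : tensor := \pi_tensor (repr s ++ repr t).
Let tzero : tensor := \pi_tensor [::].
Let topp (t : tensor) : tensor :=
  \pi_tensor [seq (- p.1, p.2) | p <- repr t].
Let tscale (c : K) (t : tensor) : tensor :=
  \pi_tensor [seq (c *: p.1, p.2) | p <- repr t].

Section TliftOps.
Variables (W : zmodType) (f : A -> B -> W).
Hypothesis bf : balanced f.

Let liftD s t : tlift f (tadd s t) = tlift f s + tlift f t.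
Proof. by rewrite tlift_pi// big_cat. Qed.

Let lift0 : tlift f tzero = 0.
Proof. by rewrite tlift_pi// big_nil. Qed.

Let liftN t : tlift f (topp t) = - tlift f t.
Proof.
rewrite tlift_pi// big_map /tlift -sumrN; apply: eq_bigr => p _ /=.
exact: balancedNl.
Qed.

Let liftZ c t : tlift f (tscale c t) = tlift (fun a b => f (c *: a) b) t.
Proof. by rewrite tlift_pi// big_map. Qed.

Definition tlift_ops := (liftD, lift0, liftN, liftZ).
End TliftOps.

Let taddA : associative tadd.
Proof. by move=> s t u; apply: tlift_inj => W f bf; rewrite !tlift_ops// addrA. Qed.

Let taddC : commutative tadd.
Proof. by move=> s t; apply: tlift_inj => W f bf; rewrite !tlift_ops// addrC. Qed.

Let tadd0 : left_id tzero tadd.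
Proof. by move=> s; apply: tlift_inj => W f bf; rewrite !tlift_ops// add0r. Qed.

Let taddN : left_inverse tzero topp tadd.
Proof. by move=> s; apply: tlift_inj => W f bf; rewrite !tlift_ops// addNr. Qed.

HB.instance Definition _ :=
  GRing.isZmodule.Build tensor taddA taddC tadd0 taddN.

Let tscaleA c d t : tscale c (tscale d t) = tscale (c * d) t.
Proof.
apply: tlift_inj => W f bf.
rewrite !tlift_ops//; last exact: balanced_scale.
by apply: eq_bigr => p _; rewrite scalerA.
Qed.

Let tscale1 : left_id 1 tscale.
Proof.
move=> t; apply: tlift_inj => W f bf; rewrite !tlift_ops//.
by apply: eq_bigr => p _; rewrite scale1r.
Qed.

Let tscaleDr : right_distributive tscale +%R.
Proof.
move=> c s t; apply: tlift_inj => W f bf; rewrite !tlift_ops//.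
exact: balanced_scale.
Qed.

Let tscaleDl t : {morph tscale^~ t : c d / c + d}.
Proof.
move=> c d; apply: tlift_inj => W f bf; rewrite !tlift_ops//.
rewrite /tlift -big_split; apply: eq_bigr => p _ /=.
by have [fD _ _] := bf; rewrite scalerDl fD.
Qed.

HB.instance Definition _ :=
  GRing.Zmodule_isLmodule.Build K tensor tscaleA tscale1 tscaleDr tscaleDl.

Lemma tliftD (W : zmodType) (f : A -> B -> W) : balanced f ->
  {morph tlift f : s t / s + t}.
Proof. by move=> bf s t; rewrite -(tlift_ops bf). Qed.

Lemma tliftZ (W : zmodType) (f : A -> B -> W) c t : balanced f ->
  tlift f (c *: t) = tlift (fun a b => f (c *: a) b) t.
Proof. by move=> bf; rewrite -(tlift_ops bf). Qed.

Lemma tlift_is_linear (W : lmodType K) (f : A -> B -> W) :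
  balanced f -> (forall c a b, f (c *: a) b = c *: f a b) ->
  linear (tlift f).
Proof.
move=> bf fZ c s t; rewrite tliftD// tliftZ// /tlift scaler_sumr.
by congr (_ + _); apply: eq_bigr => p _; rewrite fZ.
Qed.

Lemma balanced_tens : balanced tens.
Proof.
split=> [a a' b|a b b'|c a b]; apply: tlift_inj => W f bf;
  have [fDl fDr fZ] := bf; by rewrite ?tliftD// !tliftE.
Qed.

Lemma tensDl a a' b : tens (a + a') b = tens a b + tens a' b.
Proof. by case: balanced_tens. Qed.

Lemma tensDr a b b' : tens a (b + b') = tens a b + tens a b'.
Proof. by case: balanced_tens. Qed.

Lemma tensZl c a b : tens (c *: a) b = c *: tens a b.
Proof.
apply: tlift_inj => W f bf; rewrite tliftZ// !tliftE//.
exact: balanced_scale.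
Qed.

Lemma tensZr c a b : tens a (c *: b) = c *: tens a b.
Proof. by rewrite -tensZl; case: balanced_tens. Qed.

Lemma tens_ind (P : tensor -> Prop) :
  (forall a b, P (tens a b)) -> (forall s t, P s -> P t -> P (s + t)) ->
  forall t, P t.
Proof.
move=> Pt PD t.
have -> : t = \sum_(p <- repr t) tens p.1 p.2.
  apply: tlift_inj => W f bf; rewrite {1}/tlift.
  elim: (repr t) => [|p s IH].
    by rewrite !big_nil -(tlift_ops bf).
  by rewrite !big_cons tliftD// tliftE// IH.
apply: big_ind => [||p _]; [|exact: PD|exact: Pt].
have -> : 0 = tens (0 *: 0) 0 :> tensor by rewrite tensZl scale0r.
exact: Pt.
Qed.

Lemma tlift_balanced (W : lmodType K) (f : A -> B -> W) :
  (forall a, linear (f a)) -> (forall b, linear (f^~ b)) ->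
  balanced f /\ (forall c a b, f (c *: a) b = c *: f a b).
Proof.
move=> l1 l2.
have D1 a a' b : f (a + a') b = f a b + f a' b.
  by have := l2 b 1 a a'; rewrite !scale1r.
have D2 a b b' : f a (b + b') = f a b + f a b'.
  by have := l1 a 1 b b'; rewrite !scale1r.
have Z1 c a b : f (c *: a) b = c *: f a b.
  have z : f 0 b = 0 by apply: (addIr (f 0 b)); rewrite -D1 !add0r.
  by have := l2 b c a 0; rewrite addr0 z addr0.
have Z2 c a b : f a (c *: b) = c *: f a b.
  have z : f a 0 = 0 by apply: (addIr (f a 0)); rewrite -D2 !add0r.
  by have := l1 a c b 0; rewrite addr0 z addr0.
by split=> //; split=> // c a b; rewrite Z1 Z2.
Qed.

End TensorProduct.

Notation "A ⊙ B" := (tensor A B) : type_scope.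
Notation "a ⊗ b" := (tens a b) : ring_scope.

Section TensorMaps.
Context {K : comNzRingType}.
Implicit Types A B D E : lmodType K.

Lemma bilinear_balanced A B (W : lmodType K) (f : A -> B -> W) :
  (forall a, linear (f a)) -> (forall b, linear (f^~ b)) -> balanced f.
Proof. by move=> l1 l2; case: (tlift_balanced l1 l2). Qed.

Lemma bilinear_tlift A B (W : lmodType K) (f : A -> B -> W) :
  (forall a, linear (f a)) -> (forall b, linear (f^~ b)) -> linear (tlift f).
Proof.
by move=> l1 l2; case: (tlift_balanced l1 l2) => bf fZ; apply: tlift_is_linear.
Qed.

Section Tmap.
Context A B A' B' (f : {linear A -> A'}) (g : {linear B -> B'}).

Definition tmap : A ⊙ B -> A' ⊙ B' := tlift (fun a b => f a ⊗ g b).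

Let l1 a : linear (fun b => f a ⊗ g b).
Proof. by move=> c b b'; rewrite linearP tensDr tensZr. Qed.
Let l2 b : linear (fun a => f a ⊗ g b).
Proof. by move=> c a a'; rewrite linearP tensDl tensZl. Qed.

HB.instance Definition _ :=
  GRing.isLinear.Build K (A ⊙ B) (A' ⊙ B') *:%R tmap (bilinear_tlift l1 l2).

Lemma tmapE a b : tmap (a ⊗ b) = f a ⊗ g b.
Proof. exact: tliftE (bilinear_balanced l1 l2). Qed.
End Tmap.

Section Flip.
Context A B.

Definition tflip : A ⊙ B -> B ⊙ A := tlift (fun a b => b ⊗ a).

Let l1 (a : A) : linear (fun b : B => b ⊗ a).
Proof. by move=> c b b'; rewrite tensDl tensZl. Qed.
Let l2 (b : B) : linear (fun a : A => b ⊗ a).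
Proof. by move=> c a a'; rewrite tensDr tensZr. Qed.

HB.instance Definition _ :=
  GRing.isLinear.Build K (A ⊙ B) (B ⊙ A) *:%R tflip (bilinear_tlift l1 l2).

Lemma tflipE a b : tflip (a ⊗ b) = b ⊗ a.
Proof. exact: tliftE (bilinear_balanced l1 l2). Qed.
End Flip.

(* [slicel phi] is phi ⊗ id and [slicer phi] is id ⊗ phi, after identifying   *)
(* K ⊗ B with B and A ⊗ K with A.                                             *)
Section Slices.
Context A B.

Section Left.
Variable phi : {scalar A}.
Definition slicel : A ⊙ B -> B := tlift (fun a b => phi a *: b).

Let l1 (a : A) : linear (fun b : B => phi a *: b).
Proof. by move=> c b b'; rewrite scalerDr !scalerA mulrC. Qed.
Let l2 (b : B) : linear (fun a : A => phi a *: b).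
Proof. by move=> c a a'; rewrite linearP scalerDl scalerA. Qed.

HB.instance Definition _ :=
  GRing.isLinear.Build K (A ⊙ B) B *:%R slicel (bilinear_tlift l1 l2).

Lemma slicelE a b : slicel (a ⊗ b) = phi a *: b.
Proof. exact: tliftE (bilinear_balanced l1 l2). Qed.
End Left.

Section Right.
Variable phi : {scalar B}.
Definition slicer : A ⊙ B -> A := tlift (fun a b => phi b *: a).

Let l1 (a : A) : linear (fun b : B => phi b *: a).
Proof. by move=> c b b'; rewrite linearP scalerDl scalerA. Qed.
Let l2 (b : B) : linear (fun a : A => phi b *: a).
Proof. by move=> c a a'; rewrite scalerDr !scalerA mulrC. Qed.

HB.instance Definition _ :=
  GRing.isLinear.Build K (A ⊙ B) A *:%R slicer (bilinear_tlift l1 l2).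

Lemma slicerE a b : slicer (a ⊗ b) = phi b *: a.
Proof. exact: tliftE (bilinear_balanced l1 l2). Qed.
End Right.
End Slices.

Section Assoc.
Context A B D.

Let tassoc1 (b : D) : A ⊙ B -> A ⊙ (B ⊙ D) := tlift (fun x y => x ⊗ (y ⊗ b)).

Let l1 (b : D) (x : A) : linear (fun y : B => x ⊗ (y ⊗ b) : A ⊙ (B ⊙ D)).
Proof. by move=> c y y'; rewrite tensDl tensZl tensDr tensZr. Qed.
Let l2 (b : D) (y : B) : linear (fun x : A => x ⊗ (y ⊗ b) : A ⊙ (B ⊙ D)).
Proof. by move=> c x x'; rewrite tensDl tensZl. Qed.

Let tassoc1E b x y : tassoc1 b (x ⊗ y) = x ⊗ (y ⊗ b).
Proof. exact: tliftE (bilinear_balanced (l1 b) (l2 b)). Qed.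

Let tassoc1_linear b : linear (tassoc1 b).
Proof. exact: bilinear_tlift (l1 b) (l2 b). Qed.

Definition tassoc : (A ⊙ B) ⊙ D -> A ⊙ (B ⊙ D) :=
  tlift (fun s b => tlift (fun x y => x ⊗ (y ⊗ b)) s).

Let m1 s : linear (fun b => tassoc1 b s).
Proof.
move=> c b b'; move: s; apply: tens_ind => [x y|s t IHs IHt].
  by rewrite !tassoc1E !tensDr !tensZr.
have D1 d : tassoc1 d (s + t) = tassoc1 d s + tassoc1 d t.
  by have := tassoc1_linear d 1 s t; rewrite !scale1r.
by rewrite !D1 IHs IHt scalerDr addrACA.
Qed.

HB.instance Definition _ :=
  GRing.isLinear.Build K ((A ⊙ B) ⊙ D) (A ⊙ (B ⊙ D)) *:%R tassoc
    (bilinear_tlift m1 tassoc1_linear).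

Lemma tassocE a b d : tassoc ((a ⊗ b) ⊗ d) = a ⊗ (b ⊗ d).
Proof.
rewrite /tassoc tliftE; last exact: (bilinear_balanced m1 tassoc1_linear).
exact: tassoc1E.
Qed.
End Assoc.

Section MidSwap.
Context A B D E.

Let T : lmodType K := (A ⊙ D) ⊙ (B ⊙ E).

Let sw a b : D ⊙ E -> T := tlift (fun d e => (a ⊗ d) ⊗ (b ⊗ e)).

Let l1 (a : A) (b : B) (d : D) : linear (fun e : E => (a ⊗ d) ⊗ (b ⊗ e) : T).
Proof. by move=> c y y'; rewrite !tensDr !tensZr. Qed.
Let l2 (a : A) (b : B) (e : E) : linear (fun d : D => (a ⊗ d) ⊗ (b ⊗ e) : T).
Proof. by move=> c y y'; rewrite tensDr tensZr tensDl tensZl. Qed.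
Let swE (a : A) (b : B) d e : sw a b (d ⊗ e) = (a ⊗ d) ⊗ (b ⊗ e).
Proof. exact: tliftE (bilinear_balanced (l1 a b) (l2 a b)). Qed.
Let sw_linear a b : linear (sw a b).
Proof. exact: bilinear_tlift (l1 a b) (l2 a b). Qed.
Let swD a b s t : sw a b (s + t) = sw a b s + sw a b t.
Proof. by have := sw_linear a b 1 s t; rewrite !scale1r. Qed.

Let m1 t a : linear (fun b => sw a b t).
Proof.
move=> c b b'; move: t; apply: tens_ind => [x y|s t IHs IHt].
  by rewrite !swE !(tensDl, tensZl, tensDr, tensZr).
by rewrite !swD IHs IHt scalerDr addrACA.
Qed.
Let m2 t b : linear (fun a => sw a b t).
Proof.
move=> c a a'; move: t; apply: tens_ind => [x y|s t IHs IHt].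
  by rewrite !swE !(tensDl, tensZl, tensDr, tensZr).
by rewrite !swD IHs IHt scalerDr addrACA.
Qed.

Let sw2 t : A ⊙ B -> T := tlift (fun a b => sw a b t).
Let sw2E t a b : sw2 t (a ⊗ b) = sw a b t.
Proof. exact: tliftE (bilinear_balanced (m1 t) (m2 t)). Qed.
Let sw2_linear t : linear (sw2 t).
Proof. exact: bilinear_tlift (m1 t) (m2 t). Qed.
Let sw2D t s s' : sw2 t (s + s') = sw2 t s + sw2 t s'.
Proof. by have := sw2_linear t 1 s s'; rewrite !scale1r. Qed.

Let n1 s : linear (fun t => sw2 t s).
Proof.
move=> c t t'; move: s; apply: tens_ind => [a b|s s' IHs IHs'].
  by rewrite !sw2E sw_linear.
by rewrite !sw2D IHs IHs' scalerDr addrACA.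
Qed.

Definition tmidswap : (A ⊙ B) ⊙ (D ⊙ E) -> (A ⊙ D) ⊙ (B ⊙ E) :=
  tlift (fun s t =>
    tlift (fun a b => tlift (fun d e => (a ⊗ d) ⊗ (b ⊗ e)) t) s).

HB.instance Definition _ :=
  GRing.isLinear.Build K ((A ⊙ B) ⊙ (D ⊙ E)) ((A ⊙ D) ⊙ (B ⊙ E)) *:%R tmidswap
    (bilinear_tlift n1 sw2_linear).

Lemma tmidswapE a b d e :
  tmidswap ((a ⊗ b) ⊗ (d ⊗ e)) = (a ⊗ d) ⊗ (b ⊗ e).
Proof.
rewrite /tmidswap tliftE; last exact: (bilinear_balanced n1 sw2_linear).
by rewrite [LHS]sw2E swE.
Qed.
End MidSwap.

End TensorMaps.

Arguments tflip {K A B} _.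
Arguments tassoc {K A B D} _.
Arguments tmidswap {K A B D E} _.

Section MulMap.
Context {K : comNzRingType} (A : algType K).

Definition tmul : A ⊙ A -> A := tlift (fun a b => a * b).

Let l1 (a : A) : linear (fun b : A => a * b).
Proof. by move=> c b b'; rewrite mulrDr scalerAr. Qed.
Let l2 (b : A) : linear (fun a : A => a * b).
Proof. by move=> c a a'; rewrite mulrDl scalerAl. Qed.

HB.instance Definition _ :=
  GRing.isLinear.Build K (A ⊙ A) A *:%R tmul (bilinear_tlift l1 l2).

Lemma tmulE a b : tmul (a ⊗ b) = a * b.
Proof. exact: tliftE (bilinear_balanced l1 l2). Qed.
End MulMap.

Arguments tmul {K A} _.

Section TensorAlgebra.
Context {K : comNzRingType} (A B : algType K).

Let T : lmodType K := A ⊙ B.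

(* (a ⊗ b)(a' ⊗ b') = aa' ⊗ bb' *)
Let tprod (s t : T) : T := tmap tmul tmul (tmidswap (s ⊗ t)).

Let tprodE a b a' b' : tprod (a ⊗ b) (a' ⊗ b') = (a * a') ⊗ (b * b').
Proof. by rewrite /tprod tmidswapE tmapE /= !tmulE. Qed.

Let tprodDl : left_distributive tprod +%R.
Proof. by move=> s t u; rewrite /tprod tensDl !linearD. Qed.

Let tprodDr : right_distributive tprod +%R.
Proof. by move=> s t u; rewrite /tprod tensDr !linearD. Qed.

Let tprodA : associative tprod.
Proof.
move=> s t u.
move: s; apply: tens_ind => [a b|s s' IH IH']; last by rewrite !tprodDl IH IH'.
move: t; apply: tens_ind => [a' b'|t t' IH IH'].
  move: u; apply: tens_ind => [x y|u u' IH IH']; last by rewrite !tprodDr IH IH'.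
  by rewrite !tprodE !mulrA.
by rewrite tprodDl !tprodDr tprodDl IH IH'.
Qed.

Let tprod1l : left_id (1 ⊗ 1) tprod.
Proof.
move=> t; move: t; apply: tens_ind => [a b|s t IH IH']; first by rewrite tprodE !mul1r.
by rewrite tprodDr IH IH'.
Qed.

Let tprod1r : right_id (1 ⊗ 1) tprod.
Proof.
move=> t; move: t; apply: tens_ind => [a b|s t IH IH']; first by rewrite tprodE !mulr1.
by rewrite tprodDl IH IH'.
Qed.

HB.instance Definition _ := GRing.Zmodule_isPzRing.Build (A ⊙ B)
  tprodA tprod1l tprod1r tprodDl tprodDr.

Lemma tensM (a a' : A) (b b' : B) :
  (a ⊗ b) * (a' ⊗ b') = (a * a') ⊗ (b * b').
Proof. exact: tprodE. Qed.

Lemma tens1 : 1 ⊗ 1 = 1 :> A ⊙ B.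
Proof. by []. Qed.
End TensorAlgebra.

Section Structures.
Context {C : numClosedFieldType} (A : algType C).

Definition is_involution (star : A -> A) : Prop :=
  [/\ forall c a b, star (c *: a + b) = c^* *: star a + star b,
      forall a b, star (a * b) = star b * star a
    & involutive star].

(* (a ⊗ b)^* = a^* ⊗ b^*; conjugate-linear when [star] is. *)
Definition tstar (star : A -> A) : A ⊙ A -> A ⊙ A :=
  tlift (fun a b => star a ⊗ star b).

Definition is_hopf (Delta : {linear A -> A ⊙ A}) (eps : {scalar A})
    (S : {linear A -> A}) : Prop :=
  [/\ monoid_morphism Delta,
      forall a, tassoc (tmap Delta idfun (Delta a)) = tmap idfun Delta (Delta a),
      monoid_morphism eps /\
        (forall a, slicel eps (Delta a) = a /\ slicer eps (Delta a) = a)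
    & forall a, tmul (tmap S idfun (Delta a)) = (eps a)%:A /\
                tmul (tmap idfun S (Delta a)) = (eps a)%:A].

Definition mxadj (star : A -> A) n (u : 'M[A]_n) : 'M[A]_n :=
  (map_mx star u)^T.

Definition unitary_corep (star : A -> A) (Delta : {linear A -> A ⊙ A})
    n (u : 'M[A]_n) : Prop :=
  [/\ forall i j, Delta (u i j) = \sum_k u i k ⊗ u k j,
      u *m mxadj star u = 1%:M
    & mxadj star u *m u = 1%:M].

Definition unitary_coef (star : A -> A) (Delta : {linear A -> A ⊙ A})
    (a : A) : Prop :=
  exists n (u : 'M[A]_n) i j, unitary_corep star Delta u /\ a = u i j.

End Structures.

(* [cqg C] is the type of the Hopf *-algebras Pol(G): those spanned by the    *)
(* coefficients of their finite-dimensional unitary corepresentations.        *)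
Record cqg (C : numClosedFieldType) := CQG {
  pol :> algType C;
  star : pol -> pol;
  comult : {linear pol -> pol ⊙ pol};
  counit : {scalar pol};
  antipode : {linear pol -> pol};
  cqg_involution : is_involution star;
  cqg_hopf : is_hopf comult counit antipode;
  cqg_comult_star : forall a, comult (star a) = tstar star (comult a);
  cqg_span : forall a : pol, exists m (c : 'I_m -> C) (x : 'I_m -> pol),
    (forall k, unitary_coef star comult (x k)) /\ a = \sum_k c k *: x k
}.

Section Cop.
Context {C : numClosedFieldType} (G : cqg C).
Implicit Types a b : G.

Notation star := (@star C G).
Notation Delta := (comult G).
Notation eps := (counit G).
Notation S := (antipode G).

Let starL c a b : star (c *: a + b) = c^* *: star a + star b.
Proof. by case: (cqg_involution G). Qed.
Let starM a b : star (a * b) = star b * star a.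
Proof. by case: (cqg_involution G). Qed.
Let starK : involutive star.
Proof. by case: (cqg_involution G). Qed.
Let starD a b : star (a + b) = star a + star b.
Proof. by have := starL 1 a b; rewrite conjC1 !scale1r. Qed.
Let star0 : star 0 = 0.
Proof. by apply: (addIr (star 0)); rewrite -starD !add0r. Qed.
Let starZ c a : star (c *: a) = c^* *: star a.
Proof. by have := starL c a 0; rewrite star0 !addr0. Qed.
Let star1 : star 1 = 1.
Proof. by rewrite -[LHS]mulr1 -[X in _ * X]starK -starM mulr1 starK. Qed.
Let star_sum m (f : 'I_m -> G) : star (\sum_k f k) = \sum_k star (f k).
Proof. exact: (big_morph star starD star0). Qed.

Let btstar : balanced (fun a b : G => star a ⊗ star b).
Proof.
split=> [a a' b|a b b'|c a b]; first by rewrite starD tensDl.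
- by rewrite starD tensDr.
- by rewrite !starZ tensZl tensZr.
Qed.
Let tstarE a b : tstar star (a ⊗ b) = star a ⊗ star b.
Proof. exact: tliftE btstar. Qed.
Let tstarD s t : tstar star (s + t) = tstar star s + tstar star t.
Proof. exact: tliftD btstar _ _. Qed.

Definition cop_comult : G -> G ⊙ G := tflip \o Delta.
HB.instance Definition _ := GRing.Linear.on cop_comult.

(* The antipode of a Hopf *-algebra is invertible, with inverse a |-> S(a^* )^* . *)
Definition cop_antipode : G -> G := fun a => star (S (star a)).
Let cop_antipode_linear : linear cop_antipode.
Proof.
by move=> c a b; rewrite /cop_antipode starL linearP starL conjCK.
Qed.
HB.instance Definition _ :=
  GRing.isLinear.Build C G G *:%R cop_antipode cop_antipode_linear.

Let tflipM : {morph @tflip C G G : s t / s * t}.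
Proof.
move=> s t; move: s; apply: tens_ind => [a b|s s' IH IH'].
  move: t; apply: tens_ind => [x y|t t' IH IH'].
    by rewrite tensM !tflipE tensM.
  by rewrite mulrDr !linearD /= mulrDr IH IH'.
by rewrite mulrDl !linearD /= mulrDl IH IH'.
Qed.

Let counit_star a : eps (star a) = (eps a)^*.
Proof.
have [_ _ [_ e] _] := cqg_hopf G.
pose eps' b := (eps (star b))^*.
have eps'L : scalar eps'.
  by move=> c x y; rewrite /eps' starL linearP rmorphD rmorphM/= conjCK.
pose eL := GRing.isLinear.Build C G C *%R eps' eps'L.
pose E : {scalar G} := HB.pack eps' eL.
have sE t : slicel E (tstar star t) = star (slicel eps t).
  move: t; apply: tens_ind => [x y|s t IH IH'].
    by rewrite tstarE !slicelE /= /eps' starK starZ.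
  by rewrite tstarD !linearD /= starD IH IH'.
have EE b : slicel E (Delta b) = b.
  by rewrite -[b in Delta b]starK cqg_comult_star sE (e _).1 starK.
have key t : eps (slicel E t) = E (slicer eps t).
  move: t; apply: tens_ind => [x y|s t IH IH'].
    by rewrite slicelE slicerE !linearZ/= mulrC.
  by rewrite !linearD /= IH IH'.
have := key (Delta a); rewrite EE (e _).2 /= /eps' => ->.
by rewrite conjCK.
Qed.

Let cop_hopf : is_hopf cop_comult eps cop_antipode.
Proof.
have [[D1 DM] DA [e1 e] Sx] := cqg_hopf G; split.
- split=> [|a b]; rewrite /= /cop_comult /=; first by rewrite D1 tflipE.
  by rewrite DM tflipM.
- move=> a; rewrite /= /cop_comult /=.
  have -> : tassoc (tmap cop_comult idfun (tflip (Delta a))) =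
      tassoc (tmap tflip idfun (tflip (tmap idfun Delta (Delta a)))).
    congr tassoc; move: (Delta a).
    apply: tens_ind => [x y|s t IH IH']; last by rewrite !linearD /= IH IH'.
    by rewrite tflipE !tmapE /= tflipE tmapE.
  have -> : tmap idfun cop_comult (tflip (Delta a)) =
      tmap idfun tflip (tflip (tmap Delta idfun (Delta a))).
    move: (Delta a).
    apply: tens_ind => [x y|s t IH IH']; last by rewrite !linearD /= IH IH'.
    by rewrite tflipE !tmapE /= tflipE tmapE.
  rewrite -DA; move: (tmap Delta idfun (Delta a)).
  apply: tens_ind => [x z|s t IH IH']; last by rewrite !linearD /= IH IH'.
  move: x; apply: tens_ind => [x y|s t IH IH'].
    by rewrite tassocE !tflipE !tmapE /= !tflipE tassocE.
  by rewrite tensDl !linearD /= IH IH'.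
- split=> // a; rewrite /= /cop_comult /=; have [el er] := e a.
  split; [rewrite -[RHS]er|rewrite -[RHS]el]; move: (Delta a);
    apply: tens_ind => [x y|s t IH IH']; rewrite ?linearD /= ?IH ?IH'//;
    by rewrite tflipE slicelE slicerE.
- move=> a; have [Sl Sr] := Sx (star a).
  have -> : (eps a)%:A = star ((eps (star a))%:A) :> G.
    by rewrite starZ star1 counit_star conjCK.
  split; [rewrite -[in RHS]Sr|rewrite -[in RHS]Sl];
    rewrite cqg_comult_star /= /cop_comult /=; move: (Delta a);
    apply: tens_ind => [x y|s t IH IH'].
  + by rewrite tflipE tstarE !tmapE !tmulE /= starM starK.
  + by rewrite tstarD !linearD /= starD IH IH'.
  + by rewrite tflipE tstarE !tmapE !tmulE /= starM starK.
  + by rewrite tstarD !linearD /= starD IH IH'.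
Qed.

Let cop_comult_star a : cop_comult (star a) = tstar star (cop_comult a).
Proof.
rewrite /= /cop_comult /= cqg_comult_star; move: (Delta a).
apply: tens_ind => [x y|s t IH IH'].
  by rewrite tstarE !tflipE tstarE.
by rewrite tstarD !linearD /= tstarD IH IH'.
Qed.

Let cop_coef a : unitary_coef star Delta a ->
  unitary_coef star cop_comult (star a).
Proof.
case=> n [u [i [j [[uD uu1 uu2] ->]]]].
exists n, (mxadj star u), j, i; split; last by rewrite !mxE.
have uK : mxadj star (mxadj star u) = u.
  by apply/matrixP => k l; rewrite !mxE starK.
split=> [k l||]; [|by rewrite uK|by rewrite uK].
rewrite mxE mxE /= cop_comult_star /cop_comult /= uD.
rewrite (big_morph (@tflip C G G) (linearD _) (linear0 _)).
have ts0 : tstar star 0 = 0.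
  by apply: (addIr (tstar star 0)); rewrite -tstarD !add0r.
rewrite (big_morph _ tstarD ts0); apply: eq_bigr => r _.
by rewrite tflipE tstarE !mxE.
Qed.

Let cop_span (a : G) : exists m (c : 'I_m -> C) (x : 'I_m -> G),
  (forall k, unitary_coef star cop_comult (x k)) /\ a = \sum_k c k *: x k.
Proof.
have [m [c [x [xu e]]]] := cqg_span (star a).
exists m, (fun k => (c k)^*), (fun k => star (x k)); split.
  by move=> k; apply: cop_coef.
by rewrite -[LHS]starK e star_sum; apply: eq_bigr => k _; rewrite starZ.
Qed.

Definition cop : cqg C :=
  @CQG C G star cop_comult eps cop_antipode
    (cqg_involution G) cop_hopf cop_comult_star cop_span.

(* The formal identity map from Pol(G) to Pol(G^cop), and its inverse. *)
Definition tilde : {linear G -> cop} := idfun.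
Definition untilde : {linear cop -> G} := idfun.

End Cop.

Section Haar.
Context {C : numClosedFieldType} (G : cqg C).

Definition haar_state (h : {scalar G}) : Prop :=
  [/\ h 1 = 1,
      forall a : G, 0 <= h (star a * a),
      forall a : G, slicer h (comult G a) = (h a)%:A
    & forall a : G, slicel h (comult G a) = (h a)%:A].

Definition kac_type (h : {scalar G}) : Prop :=
  forall a b : G, h (a * b) = h (b * a).

(* a ⊗ b~ |-> a_(1) ⊗ b_(2)~ ⊗ a_(2) ⊗ b_(1)~ *)
Definition comult_id_cop : G ⊙ cop G -> (G ⊙ cop G) ⊙ (G ⊙ cop G) :=
  tmidswap \o tmap (comult G) (comult (cop G)).
HB.instance Definition _ := GRing.Linear.on comult_id_cop.

Definition phi_D (h : {scalar G}) : G ⊙ cop G -> C :=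
  tlift (fun a b => h (a * antipode G (untilde G b))).

Lemma phi_D_balanced (h : {scalar G}) :
  balanced (fun (a : G) (b : cop G) => h (a * antipode G (untilde G b))).
Proof.
split=> [a a' b|a b b'|c a b]; first by rewrite mulrDl linearD.
- by rewrite !linearD mulrDr linearD.
- by rewrite !linearZ /= -scalerAl -scalerAr !linearZ.
Qed.

Lemma phi_D_scalar (h : {scalar G}) : scalar (phi_D h).
Proof.
apply: (@tlift_is_linear _ _ _ C^o); first exact: phi_D_balanced.
by move=> c a b; rewrite -scalerAl linearZ.
Qed.

HB.instance Definition _ (h : {scalar G}) :=
  GRing.isLinear.Build C (G ⊙ cop G) C *%R (phi_D h) (phi_D_scalar h).

Lemma phi_DE (h : {scalar G}) (a b : G) :
  phi_D h (a ⊗ tilde G b) = h (a * antipode G b).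
Proof. exact: tliftE (phi_D_balanced h). Qed.

Definition E_map (phi : {scalar (G ⊙ cop G)}) : G ⊙ cop G -> G ⊙ cop G :=
  slicer phi \o comult_id_cop.
HB.instance Definition _ phi := GRing.Linear.on (E_map phi).

Definition Delta_tilde : G -> G ⊙ cop G := tmap idfun (tilde G) \o comult G.
HB.instance Definition _ := GRing.Linear.on Delta_tilde.

End Haar.

Arguments Delta_tilde {C} G _.
Arguments comult_id_cop {C G} _.

(* Main.v *)
(** On a coefficient [u i j] of a unitary corepresentation the antipode is [star (u j i)], so
    multiplicativity of the coproduct and invariance of the Haar state give
    [(id ⊗ h)(Δ(a)(1 ⊗ S(u i k))) = \sum_l h(a S(u i l)) u l k]. Tensoring with [u k j] and
    summing over [k] turns [E(a ⊗ u i j)] into [\sum_l h(a S(u i l)) Δ(u l j)], which lies in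
    the range of Δ~. Putting [a = u m i] and summing over [i], unitarity collapses the scalars
    to [h(1) = 1], so E fixes the range of Δ~ pointwise. *)
Require Import Defs.
From mathcomp Require Import all_boot all_order all_algebra.
From mathcomp Require Import boolp classical_sets reals.
From mathcomp Require Import complex.

Import GRing.Theory Num.Theory.

Local Open Scope ring_scope.
Local Open Scope classical_set_scope.

Section TensorSums.
Context {K : comNzRingType} (A B : lmodType K) (I : finType).

Lemma tens_suml (F : I -> A) (b : B) : (\sum_i F i) ⊗ b = \sum_i F i ⊗ b.
Proof.
apply: (big_morph (fun a => a ⊗ b) (fun a a' => tensDl a a' b)).
by apply: (addIr ((0 : A) ⊗ b)); rewrite -tensDl !add0r.
Qed.

Lemma tens_sumr (a : A) (F : I -> B) : a ⊗ (\sum_i F i) = \sum_i a ⊗ F i.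
Proof.
apply: (big_morph (tens a) (tensDr a)).
by apply: (addIr (a ⊗ (0 : B))); rewrite -tensDr !add0r.
Qed.
End TensorSums.

Section UnitaryCorepresentations.
Context {C : numClosedFieldType} (G : cqg C).

Lemma star_additive (a b : G) : star (a + b) = star a + star b.
Proof.
have [starL _ _] := cqg_involution G.
by have := starL 1 a b; rewrite conjC1 !scale1r.
Qed.

Lemma tstar_balanced : balanced (fun a b : G => star a ⊗ star b).
Proof.
have [starL _ _] := cqg_involution G.
have star0 : star (0 : G) = 0.
  by apply: (addIr (star (0 : G))); rewrite -star_additive !add0r.
have starZ c (a : G) : star (c *: a) = (c^*)%R *: star a.
  by have := starL c a 0; rewrite star0 !addr0.
split=> [a a' b|a b b'|c a b].
- by rewrite star_additive tensDl.
- by rewrite star_additive tensDr.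
- by rewrite !starZ tensZl tensZr.
Qed.

Lemma tstarE (a b : G) : tstar (@star C G) (a ⊗ b) = star a ⊗ star b.
Proof. exact: tliftE tstar_balanced. Qed.

(** [tstar] is only conjugate-linear, so sums pass through it by additivity alone. *)
Lemma tstar_sum (I : finType) (F : I -> G ⊙ G) :
  tstar (@star C G) (\sum_i F i) = \sum_i tstar (@star C G) (F i).
Proof.
apply: (big_morph _ (tliftD tstar_balanced)).
by apply: (addIr (tstar (@star C G) 0)); rewrite -(tliftD tstar_balanced) !add0r.
Qed.

Section Coefficients.
Variables (n : nat) (u : 'M[G]_n).
Hypothesis u_unitary : unitary_corep (@star C G) (comult G) u.

(** Counitality makes the matrix of counits a left unit for [u], and the right inverse
    [mxadj star u] cancels [u]. *)
Lemma counit_unitary i j : (counit G (u i j))%:A = (i == j)%:R :> G.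
Proof.
have [uD uu1 _] := u_unitary; have [_ _ [_ e] _] := cqg_hopf G.
pose eu : 'M[G]_n := \matrix_(i, j) (counit G (u i j))%:A.
have euu : eu *m u = u.
  apply/matrixP => k l; rewrite mxE -[RHS](e _).1 uD linear_sum.
  by apply: eq_bigr => m _; rewrite mxE /= slicelE mulr_algl.
have : eu = 1%:M by rewrite -[eu]mulmx1 -uu1 mulmxA euu.
by move/matrixP/(_ i j); rewrite !mxE.
Qed.

(** The antipode axiom makes [S(u)] a left inverse of [u]; it must equal the right inverse
    [mxadj star u]. *)
Lemma antipode_unitary i j : antipode G (u i j) = star (u j i).
Proof.
have [uD uu1 _] := u_unitary; have [_ _ _ Sx] := cqg_hopf G.
have Suu : map_mx (antipode G) u *m u = 1%:M.
  apply/matrixP => k l; rewrite [RHS]mxE -counit_unitary -(Sx _).1 uD [tmap _ _ _]linear_sum linear_sum mxE.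
  by apply: eq_bigr => m _; rewrite mxE /= tmapE tmulE.
have : map_mx (antipode G) u = mxadj (@star C G) u.
  by rewrite -[LHS]mulmx1 -uu1 mulmxA Suu mul1mx.
by move/matrixP/(_ i j); rewrite !mxE.
Qed.

Lemma comult_star_unitary i j :
  comult G (star (u i j)) = \sum_k star (u i k) ⊗ star (u k j).
Proof.
have [uD _ _] := u_unitary.
by rewrite cqg_comult_star uD tstar_sum; apply: eq_bigr => k _; rewrite tstarE.
Qed.

Lemma Delta_tilde_unitary i j :
  Delta_tilde G (u i j) = \sum_k u i k ⊗ tilde G (u k j).
Proof.
have [uD _ _] := u_unitary.
rewrite /Delta_tilde /= uD [LHS]linear_sum.
by apply: eq_bigr => k _; apply: tmapE.
Qed.

Section Invariance.
Variable h : {scalar G}.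
Hypothesis h_haar : haar_state h.

(** [id ⊗ h] is a right module map for multiplication on the first leg. *)
Lemma slicer_mul_tens (t : G ⊙ G) (x y : G) :
  slicer h (t * (x ⊗ y)) = slicer h (t * (1 ⊗ y)) * x.
Proof.
move: t; apply: tens_ind => [a b|s t IHs IHt].
  by rewrite !tensM !slicerE mulr1 scalerAl.
by rewrite !mulrDl !linearD /= IHs IHt mulrDl.
Qed.

Lemma haar_strong_invariance (a : G) i k :
  slicer h (comult G a * (1 ⊗ antipode G (u i k))) =
  \sum_l h (a * antipode G (u i l)) *: u l k.
Proof.
have [_ _ u1] := u_unitary; have [_ _ hr _] := h_haar.
have [[_ DM] _ _ _] := cqg_hopf G.
pose f m := slicer h (comult G a * (1 ⊗ star (u m i))).
(* Invariance of [h] at [a * star (u l i)] gives a linear system for the [f m]. It is solved by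
   multiplying on the right by [u l k] and summing over [l], since [mxadj star u *m u = 1]. *)
have fE l : (h (a * star (u l i)))%:A = \sum_m f m * star (u l m).
  rewrite -hr DM comult_star_unitary mulr_sumr linear_sum.
  by apply: eq_bigr => m _; rewrite /= slicer_mul_tens.
transitivity (f k); first by rewrite antipode_unitary.
under [RHS]eq_bigr => l _ do
  rewrite antipode_unitary -mulr_algl fE mulr_suml.
rewrite exchange_big (bigD1 k) //=.
have uu m : \sum_l star (u l m) * u l k = (m == k)%:R.
  have /matrixP/(_ m k) := u1; rewrite !mxE => <-.
  by apply: eq_bigr => l _; rewrite !mxE.
under eq_bigr => l _ do rewrite -mulrA.
rewrite -mulr_sumr uu eqxx mulr1 big1 ?addr0 // => m /negPf mk.
under eq_bigr => l _ do rewrite -mulrA.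
by rewrite -mulr_sumr uu mk mulr0.
Qed.

(** The middle swap pairs the second leg of [t] with [y], so slicing by [phi_D] reduces to slicing
    by [h], with [x] left outside. *)
Lemma slicer_phi_D (t : G ⊙ G) (x y : G) :
  slicer (phi_D h) (tmidswap (t ⊗ (tilde G x ⊗ tilde G y))) =
  slicer h (t * (1 ⊗ antipode G y)) ⊗ tilde G x.
Proof.
move: t; apply: tens_ind => [a b|s t IHs IHt].
  by rewrite tmidswapE tensM !slicerE mulr1 /= phi_DE tensZl.
by rewrite mulrDl tensDl !linearD /= IHs IHt tensDl.
Qed.

Lemma E_map_unitary (a : G) i j :
  E_map (phi_D h) (a ⊗ tilde G (u i j)) =
  Delta_tilde G (\sum_l h (a * antipode G (u i l)) *: u l j).
Proof.
have [uD _ _] := u_unitary.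
(* The flipped coproduct sends [u i k] into [phi_D] and keeps [u k j] outside. *)
have copD : comult (cop G) (tilde G (u i j)) =
    \sum_k tilde G (u k j) ⊗ tilde G (u i k).
  rewrite /= /cop_comult /= uD linear_sum.
  by apply: eq_bigr => k _; rewrite /= tflipE.
rewrite /E_map /comult_id_cop /= tmapE copD.
rewrite tens_sumr [tmidswap _]linear_sum [LHS]linear_sum.
transitivity (\sum_k (\sum_l h (a * antipode G (u i l)) *: u l k) ⊗ tilde G (u k j)).
  by apply: eq_bigr => k _; rewrite -haar_strong_invariance; apply: slicer_phi_D.
transitivity (\sum_k \sum_l (h (a * antipode G (u i l)) *: u l k) ⊗ tilde G (u k j)).
  by apply: eq_bigr => k _; apply: tens_suml.
(* For fixed [l], the sum over [k] now assembles the coproduct of [u l j]. *)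
rewrite exchange_big [RHS]linear_sum; apply: eq_bigr => l _ /=.
rewrite linearZ /= Delta_tilde_unitary scaler_sumr.
by apply: eq_bigr => k _; apply: tensZl.
Qed.

Lemma E_map_Delta_tilde_unitary i j :
  E_map (phi_D h) (Delta_tilde G (u i j)) = Delta_tilde G (u i j).
Proof.
have [_ uu1 _] := u_unitary; have [h1 _ _ _] := h_haar.
rewrite {1}Delta_tilde_unitary [LHS]linear_sum.
under eq_bigr => k _ do rewrite /= E_map_unitary.
(* With the sum over [k] moved inside [h], the coefficient of [u l j] is [h] of the [(i, l)] entry
   of [u *m mxadj star u]. *)
rewrite -linear_sum /= exchange_big; congr (Delta_tilde G _).
under eq_bigr => l _ do rewrite -scaler_suml -linear_sum.
have uu l : \sum_k u i k * antipode G (u k l) = (i == l)%:R.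
  have /matrixP/(_ i l) := uu1; rewrite !mxE => <-.
  by apply: eq_bigr => k _; rewrite !mxE antipode_unitary.
rewrite (bigD1 i) //= uu eqxx h1 scale1r big1 ?addr0 // => l li.
by rewrite uu eq_sym (negPf li) linear0 scale0r.
Qed.

End Invariance.
End Coefficients.
End UnitaryCorepresentations.

Theorem theorem3p2 (R : realType) (G : cqg R[i]) (h : {scalar G})
    (h_haar : haar_state h) (h_kac : kac_type h) :
  Delta_tilde G @` [set: G] = E_map (phi_D h) @` [set: G ⊙ cop G].
Proof.
apply/seteqP; split=> [_ [c _ <-]|_ [t _ <-]].
  (* The element is its own preimage, because [E_map] fixes the range of [Delta_tilde]. *)
  exists (Delta_tilde G c) => //.
  have [m [d [x [xu ->]]]] := cqg_span c.
  rewrite (linear_sum (Delta_tilde G)) [LHS]linear_sum; apply: eq_bigr => k _ /=.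
  have [n [u [i [j [uu ->]]]]] := xu k.
  by rewrite !linearZ /= (E_map_Delta_tilde_unitary _ _ _ uu _ h_haar).
suff [c cE] : exists c, Delta_tilde G c = E_map (phi_D h) t by exists c.
move: t; apply: tens_ind => [a b|s t [c cE] [d dE]]; last first.
  by exists (c + d); rewrite !linearD /= cE dE.
(* With [a] fixed, the second leg is expanded in unitary coefficients of [G] itself, not of
   [cop G]. *)
pose P y := exists c, Delta_tilde G c = E_map (phi_D h) (a ⊗ tilde G y).
suff : P (untilde G b) by [].
have [m [d [x [xu ->]]]] := cqg_span (untilde G b).
apply: (big_ind P) => [|y z [c cE] [c' c'E]|k _].
- exists 0; rewrite linear0.
  by rewrite -[tilde G 0](scale0r (tilde G 0)) tensZr scale0r linear0.
- by exists (c + c'); rewrite !linearD tensDr linearD /= cE c'E.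
- have [n [u [i [j [uu ->]]]]] := xu k.
  exists (d k *: \sum_l h (a * antipode G (u i l)) *: u l j).
  by rewrite !linearZ tensZr linearZ /= (E_map_unitary _ _ _ uu _ h_haar).
Qed.
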